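(* Let $U\subset R_A^m(-\mathbf d)$ be a quasi-stable module and let $F=\{f_{\alpha,k}\}_{x^\alpha\mathbf e_k\in\mathcal P_U}$ be a $U$-marked basis. Let $U'\subset\bigoplus_{x^\alpha\mathbf e_k\in\mathcal P_U}R_A(-\deg(x^\alpha\mathbf e_k))\,\mathbf f_{\alpha,k}$ be the stable module with Pommaret basis $\mathcal P_{U'}=\{x_i\mathbf f_{\alpha,k}\mid x^\alpha\mathbf e_k\in\mathcal P_U,\ x_i>\min(x^\alpha)\}$. Then for every $x^\alpha\mathbf e_k\in\mathcal P_U$ and every non-multiplicative variable $x_i$ of $x^\alpha$, the support of the fundamental syzygy $S_{i,\alpha,k}$ of $F$ is contained in $$\{x_i\,\mathbf f_{\alpha,k}\}\ \cup\ \Bigl(\ \bigcup_{x^\gamma\mathbf e_\ell\in\mathcal P_U}\bigl\{x^\eta\,\mathbf f_{\gamma,\ell}\ \big|\ x^\eta x^\gamma\in\mathcal C_i(x^\gamma),\ \deg(x^\eta)=\deg(x^\alpha\mathbf e_k)+1-\deg(x^\gamma\mathbf e_\ell)\bigr\}\ \cap\ \mathcal N(U')\Bigr).$$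
   Context: $\mathbb K$ is a field, $R=\mathbb K[x_0,\dots,x_n]$ with the standard grading and $x_0<\dots<x_n$; $A$ is a Noetherian $\mathbb K$-algebra and $R_A=R\otimes_{\mathbb K}A=A[x_0,\dots,x_n]$. A term of $R$ is a monomial $x^\alpha$; for $x^\alpha\neq1$, $\min(x^\alpha)$ and $\max(x^\alpha)$ are the smallest and the largest variable dividing it. Variables $x_i>\min(x^\alpha)$ are called non-multiplicative for $x^\alpha$ (the term $1$ has no non-multiplicative variables; in particular it contributes no $x_i\mathbf f_{\alpha,k}$). For $\mathbf d=(d_1,\dots,d_m)\in\mathbb Z^m$, $R_A^m(-\mathbf d)=\bigoplus_k R_A(-d_k)\mathbf e_k$; its terms are the elements $x^\alpha\mathbf e_k$, of degree $|\alpha|+d_k$. The support $\mathrm{Supp}(f)$ is the set of terms with non-zero coefficient in $f$. A submodule is monomial if it is generated by terms; $\mathcal N(U)$ is the set of terms not in the monomial module $U$. The Pommaret cone is $\mathcal C(x^\alpha)=\{x^\delta x^\alpha\mid \delta_i=0\ \forall x_i>\min(x^\alpha)\}$ for $x^\alpha\ne1$, $\mathcal C(1)$ is the set of all terms, and $\mathcal C(x^\alpha\mathbf e_k)=\mathcal C(x^\alpha)\mathbf e_k$. A Pommaret basis of $U$ is a set $T$ of terms generating $U$ such that the set of terms in $U$ is the disjoint union of the cones of the elements of $T$; it is unique if it exists and is denoted $\mathcal P_U$. $U$ is quasi-stable if it has a finite Pommaret basis, and stable if moreover $\mathcal P_U$ equals its minimal monomial generating set. The $i$-sliced Pommaret cone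 is $\mathcal C_i(x^\gamma)=\{x^\delta x^\gamma\mid \max(x^\delta)\le\min\{x_{i-1},\min(x^\gamma)\}\}$ (with $x^\delta=1$ always allowed; if $x^\gamma=1$ the condition is only $\max(x^\delta)\le x_{i-1}$). A $U$-marked set is a finite set $F=\{f_{\alpha,k}\}_{x^\alpha\mathbf e_k\in\mathcal P_U}$ of homogeneous elements such that $x^\alpha\mathbf e_k$ has coefficient $1$ in $f_{\alpha,k}$ and $\mathrm{Supp}(f_{\alpha,k}-x^\alpha\mathbf e_k)\subseteq\mathcal N(U)$. It is a $U$-marked basis if $(R_A^m(-\mathbf d))_s=(F)_s\oplus\langle\mathcal N(U)_s\rangle_A$ for all $s$, where $(F)$ is the submodule generated by $F$. If $F$ is a $U$-marked basis, each $f\in(F)$ can be uniquely written as $f=\sum_{x^\gamma\mathbf e_\ell\in\mathcal P_U}P_{\gamma,\ell}f_{\gamma,\ell}$ with $P_{\gamma,\ell}\in R_A$ and all terms of $P_{\gamma,\ell}\,x^\gamma$ in $\mathcal C(x^\gamma)$. For $x_i>\min(x^\alpha)$, the fundamental syzygy is $S_{i,\alpha,k}=x_i\mathbf f_{\alpha,k}-\sum P_{\gamma,\ell}\mathbf f_{\gamma,\ell}$, where $x_if_{\alpha,k}=\sum P_{\gamma,\ell}f_{\gamma,\ell}$ is this unique writing. *)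

(* Defs.v *)
From HB Require Import structures.
From mathcomp Require Import all_boot all_order all_algebra.
From mathcomp Require Import finmap.
From mathcomp Require Import mpoly.

Set Implicit Arguments.
Unset Strict Implicit.
Unset Printing Implicit Defensive.

Import GRing.Theory.
Local Open Scope ring_scope.

Section Modules.

Variables (R : nzRingType) (V : lmodType R).

Definition submodule (U : V -> Prop) : Prop :=
  U 0 /\ forall (c : R) (u v : V), U u -> U v -> U (c *: u + v).

Definition span (S : V -> Prop) (v : V) : Prop :=
  exists s : seq (R * V),
    (forall c, c \in s -> S c.2) /\ v = \sum_(c <- s) c.1 *: c.2.

Definition direct_sum (W X Y : V -> Prop) : Prop :=
  (forall v, W v <-> exists x y, [/\ X x, Y y & v = x + y]) /\
  (forall v, X v -> Y v -> v = 0).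

End Modules.

Definition noetherian (A : comNzRingType) : Prop :=
  forall J : A^o -> Prop, submodule J ->
  exists s : seq A^o, forall x, J x <-> span (fun y => y \in s) x.

Section Monomials.

Variable n : nat.
Implicit Types (a g h : 'X_{1..n.+1}) (i : 'I_n.+1).

(* Index of the smallest variable dividing [x^a].  For [x^a = 1] it is [n.+1],
   beyond every variable: 1 has no non-multiplicative variables and its cone
   is everything. *)
Definition mmin a : nat := \big[minn/n.+1]_(i < n.+1 | a i != 0%N) i.

(* Index of the largest variable dividing [x^a]; the value 0 at [x^a = 1] is
   never used, see [sliced_cone]. *)
Definition mmax a : nat := \max_(i < n.+1 | a i != 0%N) i.

Definition nonmult a i : bool := (mmin a < i)%N.

Definition cone g h : Prop :=
  exists a, (forall i, nonmult g i -> a i = 0%N) /\ h = (a + g)%MM.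

(* [max(x^a) <= x_{i-1}] is written [mmax a < i], which is also correct
   when [i = 0]. *)
Definition sliced_cone i g h : Prop :=
  exists a, (a = 0%MM \/ (mmax a < i)%N /\ (mmax a <= mmin g)%N) /\
    h = (a + g)%MM.

End Monomials.

(* The free module with basis indexed by [I]; [^o] makes it a module over the
   polynomial ring.  Degree shifts only enter through [tdeg]. *)
Definition free_mod (A : comNzRingType) (n : nat) (I : finType) :=
  {ffun I -> {mpoly A[n.+1]}^o}.

Definition term (n : nat) (I : Type) := ('X_{1..n.+1} * I)%type.

Section Terms.

Variables (A : comNzRingType) (n : nat) (I : finType).
Notation M := (free_mod A n I).
Notation T := (term n I).
Implicit Types (U : M -> Prop) (t : T) (v : M).

Definition tmon t : M := [ffun j => if j == t.2 then 'X_[t.1] else 0].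

Definition term_coef v t : A := (v t.2 : {mpoly A[n.+1]})@_t.1.

Definition in_supp v t : Prop := term_coef v t != 0.

Definition tdeg (d : I -> int) t : int := (mdeg t.1)%:Z + d t.2.

Definition homog_of (d : I -> int) (s : int) v : Prop :=
  forall t, in_supp v t -> tdeg d t = s.

Definition homogeneous (d : I -> int) v : Prop := exists s, homog_of d s v.

Definition tspan (G : T -> Prop) : M -> Prop :=
  span (fun v => exists2 t, G t & v = tmon t).

(* The [A]-linear (not [A[x]]-linear) span of a set of terms. *)
Definition Aspan (G : T -> Prop) (v : M) : Prop :=
  exists s : seq (A * T),
    (forall c, c \in s -> G c.2) /\ v = \sum_(c <- s) c.1%:MP *: tmon c.2.

Definition generates (G : T -> Prop) U : Prop := forall v, U v <-> tspan G v.

Definition monomial U : Prop := exists G : T -> Prop, generates G U.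

Definition normal_terms U t : Prop := ~ U (tmon t).

Definition tcone (g t : T) : Prop := cone g.1 t.1 /\ t.2 = g.2.

Definition pommaret_basis U (G : T -> Prop) : Prop :=
  [/\ generates G U,
      forall t, U (tmon t) <-> exists2 g, G g & tcone g t
    & forall g g' t, G g -> G g' -> tcone g t -> tcone g' t -> g = g'].

Definition minimal_generators U (G : T -> Prop) : Prop :=
  generates G U /\
  forall G' : T -> Prop, (forall t, G' t -> G t) -> generates G' U ->
  forall t, G t -> G' t.

Definition quasi_stable U : Prop :=
  monomial U /\ exists P : {fset T}, pommaret_basis U (fun t => t \in P).

Definition stable U : Prop :=
  monomial U /\ exists P : {fset T},
    pommaret_basis U (fun t => t \in P) /\
    minimal_generators U (fun t => t \in P).

End Terms.

Section Marked.

Variables (A : comNzRingType) (n m : nat) (d : 'I_m -> int).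
Notation M := (free_mod A n 'I_m).
Variables (U : M -> Prop) (P : {fset term n 'I_m}).

Definition marked_set (F : P -> M) : Prop :=
  forall a : P,
    [/\ homogeneous d (F a), term_coef (F a) (val a) = 1
      & forall t, in_supp (F a - tmon A (val a)) t -> normal_terms U t].

Definition gen_by (F : P -> M) : M -> Prop := span (fun v => exists a, v = F a).

Definition marked_basis (F : P -> M) : Prop :=
  marked_set F /\
  forall s : int,
    direct_sum (homog_of d s)
      (fun v => gen_by F v /\ homog_of d s v)
      (Aspan (fun t => normal_terms U t /\ tdeg d t = s)).

Definition cone_writing (F : P -> M) (Q : P -> {mpoly A[n.+1]}) (v : M) : Prop :=
  v = \sum_(c : P) Q c *: F c /\
  forall (c : P) h, h \in msupp (Q c) -> cone (val c).1 (h + (val c).1)%MM.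

(* The basis element [f_c] of the free module indexed by [P] is [tmon (0, c)]. *)
Definition fundamental_syzygy (F : P -> M) (i : 'I_n.+1) (a : P)
    (S : free_mod A n P) : Prop :=
  exists Q : P -> {mpoly A[n.+1]},
    cone_writing F Q ('X_i *: F a) /\
    S = 'X_i *: tmon A (0%MM, a) - \sum_(c : P) Q c *: tmon A (0%MM, c).

End Marked.

(* The terms [x_i f_a] with [a] in [P] and [x_i] non-multiplicative for [a]. *)
Definition syz_heads (n m : nat) (P : {fset term n 'I_m}) (t : term n P) : Prop :=
  exists i : 'I_n.+1, nonmult (val t.2).1 i /\ t.1 = U_(i)%MM.

(* Main.v *)
Require Import Defs.
From HB Require Import structures.
From mathcomp Require Import all_boot all_order all_algebra.
From mathcomp Require Import finmap.
From mathcomp Require Import mpoly.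
From mathcomp Require Import zify.

Set Implicit Arguments.
Unset Strict Implicit.
Unset Printing Implicit Defensive.

Import GRing.Theory.
Local Open Scope ring_scope.

(** Why the support is so small.  The syzygy is read off the cone writing
    [x_i f_a = sum_c Q_c f_c], so everything is a statement about the terms
    [x^h] of the coefficients [Q_c].

    Compare coefficients at the term [x^h x^c], where [x^c] is the head of
    [f_c].  Cones are disjoint, so no other product of a term of a coefficient
    with a head reaches this term.  Hence it occurs in [x_i f_a], or it is
    [x^h' x^nu] with [x^h'] a term of some [Q_c'] and [x^nu] a tail term of
    [f_c'].  In the second case [x^nu] lies outside [U] while [x^h x^c] lies
    in the cone of [x^c], and this forces [x^h] to be strictly smaller than
    [x^h'] in the lexicographic order that compares the largest variable first
    ([tail_collision_lt]).  The coefficients have finitely many terms, so a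
    property of the pairs [(c, h)] holds for all of them as soon as it holds
    when [x^h x^c] occurs in [x_i f_a] and passes from [(c', h')] to [(c, h)]
    along such collisions ([cone_writing_ind]).

    The property used is that [x^h] only involves variables below [x_i] and has
    the expected degree.  It passes along collisions because of the order and of
    homogeneity.  It holds initially because a term [x_i x^nu] of [x_i f_a] has
    either [x^nu] outside [U] or [x^nu = x^a]: if a variable [x_j] with
    [j >= i] divided [x^h], one could cancel [x_i] from [x^h], so [x^nu] would
    lie in the cone of [x^c] and [x_i] would be multiplicative for [x^c]
    ([shift_cone_low]); then [x^nu] is in [U], hence [x^c = x^a] by
    disjointness, but [x_i] is non-multiplicative for [x^a].  Normality with
    respect to [U'] is the condition that [x^h] has no non-multiplicative
    variable of [x^c], which is part of being a cone writing.

    The module [U'] exists because a term [x^b f_c] divisible by some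
    non-multiplicative variable of [x^c] lies in exactly one cone, that of
    [x_j f_c] with [x_j] the largest variable of [x^b]. *)

(** * Minimal and maximal variables, and a lexicographic order *)

Lemma leq_bigmin (I : Type) (r : seq I) (p : pred I) (f : I -> nat) x k :
  (k <= \big[minn/x]_(i <- r | p i) f i)%N =
  (k <= x)%N && all (fun i => p i ==> (k <= f i)%N) r.
Proof.
elim: r => [|i r IH]; first by rewrite big_nil andbT.
rewrite big_cons /=; case: (p i) => //=.
by rewrite leq_min IH andbCA.
Qed.

Section Monomials.

Variable n : nat.
Implicit Types (a b g h u : 'X_{1..n.+1}) (i j k : 'I_n.+1).

Lemma nonmultPn g i :
  reflect (forall j : 'I_n.+1, (j < i)%N -> g j = 0%N) (~~ nonmult g i).
Proof.
rewrite /nonmult -leqNgt leq_bigmin [(i <= n.+1)%N]ltnW //=.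
apply: (iffP allP) => [H j ji|H j _].
  apply/eqP; apply: contraTT ji => gj; rewrite -leqNgt.
  by move/implyP: (H j (mem_index_enum _)); apply.
by apply/implyP; rewrite leqNgt; apply: contra => ji; apply/eqP/H.
Qed.

Lemma nonmultP g i :
  reflect (exists2 j : 'I_n.+1, (j < i)%N & g j != 0%N) (nonmult g i).
Proof.
apply: (iffP idP) => [gi|[j ji]]; last first.
  by apply: contraNT => /nonmultPn H; apply/eqP/H.
have /existsP[j /andP[]] : [exists j : 'I_n.+1, (j < i)%N && (g j != 0%N)].
  apply: contraTT gi => /existsPn H; apply/nonmultPn => j ji.
  by move: (H j); rewrite ji => /negbNE/eqP.
by exists j.
Qed.

Lemma mmin_leP g k :
  reflect (forall j : 'I_n.+1, g j != 0%N -> (k <= j)%N) (k <= mmin g)%N.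
Proof.
rewrite leq_bigmin [(k <= n.+1)%N]ltnW //=.
apply: (iffP allP) => [H j|H j _]; last by apply/implyP; exact: H.
exact/implyP/H/mem_index_enum.
Qed.

Lemma coneP g h :
  cone g (h + g)%MM <-> (forall i, nonmult g i -> h i = 0%N).
Proof.
split=> [[a [ha]]|H]; last by exists h.
by move/addIm => ->.
Qed.

Lemma cone_refl g : cone g g.
Proof. by exists 0%MM; rewrite add0m; split=> // i _; rewrite mnm0E. Qed.

Lemma coneXP i h :
  cone U_(i) (h + U_(i))%MM <-> forall j : 'I_n.+1, (i < j)%N -> h j = 0%N.
Proof.
rewrite coneP; split=> H j ij; apply: H.
  by apply/nonmultP; exists i; rewrite // mnm1E eqxx.
by case/nonmultP: ij => k kj; rewrite mnm1E; have [->|] := eqVneq i k.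
Qed.

Lemma unit_cones_disjoint i j h : cone U_(i) h -> cone U_(j) h -> i = j.
Proof.
suff H (k l : 'I_n.+1) : (k < l)%N -> cone U_(k) h -> ~ cone U_(l) h.
  move=> ci cj; case: (ltngtP i j) => [ij|ji|/val_inj //].
    by case: (H _ _ ij ci).
  by case: (H _ _ ji cj).
move=> kl [u [uk ->]] [w [_ /mnmP/(_ l)]].
rewrite !mnmDE !mnm1E eqxx uk; last first.
  by apply/nonmultP; exists k; rewrite // mnm1E eqxx.
by have /negPf -> : k != l; rewrite ?neq_ltn ?kl // addn1.
Qed.

Definition revlex_lt h h' : bool :=
  [exists j : 'I_n.+1, (h j < h' j)%N &&
    [forall k : 'I_n.+1, (j < k)%N ==> (h k == h' k)]].

Lemma revlex_ltP h h' :
  reflect (exists2 j, (h j < h' j)%N & forall k : 'I_n.+1, (j < k)%N -> h k = h' k)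
          (revlex_lt h h').
Proof.
apply: (iffP existsP) => -[j].
  case/andP=> hj /forallP H; exists j => // k jk.
  by apply/eqP; move/implyP: (H k); apply.
move=> hj H; exists j; rewrite hj; apply/forallP => k; apply/implyP => jk.
exact/eqP/H.
Qed.

Lemma revlex_lt_irr : irreflexive revlex_lt.
Proof. by move=> h; apply/negbTE/negP => /revlex_ltP[j]; rewrite ltnn. Qed.

Lemma revlex_lt_trans : transitive revlex_lt.
Proof.
move=> h2 h1 h3 /revlex_ltP[j hj Hj] /revlex_ltP[k hk Hk].
apply/revlex_ltP; case: (ltngtP j k) => jk.
- by exists k => [|l kl]; [rewrite Hj | rewrite Hj ?Hk // (ltn_trans jk)].
- by exists j => [|l jl]; [rewrite -Hk | rewrite Hj ?Hk // (ltn_trans jk)].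
- move/val_inj: jk hk Hk => <- hk Hk.
  by exists j => [|l jl]; [exact: ltn_trans hk | rewrite Hj ?Hk].
Qed.

(** At the largest variable where [h] and [h'] differ, [h] cannot be the larger
    one: otherwise that variable is multiplicative for [x^g], so [x^g] has no
    smaller variable, [x^h'] divides [x^h] and cancelling it leaves [x^u] in the
    cone of [x^g]. *)
Lemma tail_collision_lt g h h' u :
  cone g (h + g)%MM -> ~ cone g u -> (h + g = h' + u)%MM -> revlex_lt h h'.
Proof.
move=> /coneP hg ncu e.
have E k : (h k + g k = h' k + u k)%N by rewrite -!mnmDE e.
case: (pickP (fun j => h j != h' j)) => [j0 hj0|H]; last first.
  case: ncu; suff -> : u = g by exact: cone_refl.
  by apply/mnmP => k; have /negbFE/eqP hk := H k; move: (E k); rewrite hk; lia.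
case: (@arg_maxnP _ j0 (fun j => h j != h' j) val hj0) => j hj jmax.
have above (k : 'I_n.+1) : (j < k)%N -> h k = h' k.
  move=> jk; apply/eqP/negPn/negP => /jmax /=.
  by rewrite leqNgt jk.
case: (ltngtP (h j) (h' j)) hj => // lt_j _; first by apply/revlex_ltP; exists j.
have /nonmultPn gj : ~~ nonmult g j.
  by apply/negP => /hg hj; rewrite hj in lt_j.
case: ncu; exists (h - h')%MM; split=> [k /hg|].
  by rewrite mnmBE => ->; rewrite sub0n.
apply/mnmP => k; rewrite mnmDE mnmBE; move: (E k).
case: (ltngtP k j) => [/gj|/above|/val_inj ->]; lia.
Qed.

(** Suppose a variable [x_j] with [j >= i] divides [x^h].  It is multiplicative
    for [x^g], so [x^g] has no variable below [x_j]; as [x_i] divides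
    [x^h x^g], it divides [x^h].  Cancelling it puts [x^u] in the cone of
    [x^g], and dividing [x^h] makes [x_i] multiplicative for [x^g].  The last
    hypothesis excludes this both for [x^u] outside the cone and for
    [x^u = x^g] with [x_i] non-multiplicative. *)
Lemma shift_cone_low i g h u :
  cone g (h + g)%MM -> (h + g = U_(i) + u)%MM -> (cone g u -> nonmult g i) ->
  forall j : 'I_n.+1, (i <= j)%N -> h j = 0%N.
Proof.
move=> /coneP hg e ncu j ij; apply/eqP/negPn/negP => hj.
have E k : (h k + g k = (i == k) + u k)%N by rewrite -mnm1E -!mnmDE e.
have /nonmultPn gj : ~~ nonmult g j by apply: contra hj => /hg ->.
have hi : (0 < h i)%N.
  case: (ltngtP i j) ij => // [ij|/val_inj -> _]; last by rewrite lt0n.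
  by move: (E i); rewrite gj // eqxx; lia.
have gi : nonmult g i.
  apply: ncu; exists (h - U_(i))%MM; split=> [k /hg|].
    by rewrite mnmBE => ->; rewrite sub0n.
  apply/mnmP => k; rewrite mnmDE mnmBE mnm1E; move: (E k).
  by case: eqP => [<-|]; lia.
by rewrite (hg _ gi) in hi.
Qed.

Lemma sliced_coneI i g h :
  cone g (h + g)%MM -> (forall j : 'I_n.+1, (i <= j)%N -> h j = 0%N) ->
  sliced_cone i g (h + g)%MM.
Proof.
move=> /coneP hg hi; exists h; split=> //.
have [->|nz] := eqVneq h 0%MM; [by left | right].
have [j0 hj0] : exists j, h j != 0%N.
  apply/existsP; apply: contraNT nz => /existsPn H.
  by apply/eqP/mnmP => k; rewrite mnm0E; apply/eqP; move: (H k); rewrite negbK.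
have [j hj ->] : exists2 j : 'I_n.+1, h j != 0%N & mmax h = j.
  case: (@eq_bigmax_cond _ (fun j => h j != 0%N) val) => [|j hj e].
    by apply/card_gt0P; exists j0.
  by exists j.
split; first by rewrite ltnNge; apply: contra hj => /hi ->.
apply/mmin_leP => k gk; rewrite leqNgt; apply: contra hj => kj.
by apply/eqP/hg/nonmultP; exists k.
Qed.

End Monomials.

(** The number of elements of [s] above [x] drops when [x] is replaced by one of
    them. *)
Lemma finite_order_ind (T : eqType) (r : rel T) (s : seq T) (Q : T -> Prop) :
  irreflexive r -> transitive r ->
  (forall x, x \in s -> (forall y, y \in s -> r x y -> Q y) -> Q x) ->
  forall x, x \in s -> Q x.
Proof.
move=> irr tr step x.
have [k] := ubnP (count (r x) s); elim: k x => // k IH x ltk xs.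
apply: step => // y ys rxy; apply: IH => //; rewrite ltnS in ltk.
apply: leq_trans ltk.
have sub : subpred (predU (pred1 y) (r y)) (r x).
  by move=> z /= /predU1P[->|] //; exact: tr.
apply: leq_trans (sub_count sub s).
have I0 : count (predI (pred1 y) (r y)) s = 0%N.
  rewrite -(count_pred0 s); apply: eq_count => z /=.
  by have [->|//] := eqVneq z y; rewrite irr.
by rewrite -[ltnRHS]addn0 -I0 count_predUI -addn1 addnC leq_add2r -has_count has_pred1.
Qed.

(** * Terms occurring in elements of a free module *)

Section Supports.

Variables (A : comNzRingType) (n : nat) (I : finType).
Notation M := (free_mod A n I).
Implicit Types (v w : M) (t g : term n I) (p : {mpoly A[n.+1]}) (G : term n I -> Prop).

Lemma term_coefD v w t : term_coef (v + w) t = term_coef v t + term_coef w t.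
Proof. by rewrite /term_coef ffunE mcoeffD. Qed.

Lemma term_coefB v w t : term_coef (v - w) t = term_coef v t - term_coef w t.
Proof. by rewrite /term_coef !ffunE mcoeffB. Qed.

Lemma term_coef_sum (J : Type) (r : seq J) (f : J -> M) t :
  term_coef (\sum_(j <- r) f j) t = \sum_(j <- r) term_coef (f j) t.
Proof.
by elim/big_rec2: _ => [|j x y _ <-]; rewrite ?term_coefD // /term_coef ffunE mcoeff0.
Qed.

Lemma supp_sum (J : eqType) (r : seq J) (f : J -> M) t :
  in_supp (\sum_(j <- r) f j) t -> exists2 j, j \in r & in_supp (f j) t.
Proof.
rewrite /in_supp term_coef_sum => nz; apply/hasP.
apply: contraNT nz => /hasPn H; apply/eqP; rewrite big_seq big1 // => j jr.
by apply/eqP/negbNE/H.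
Qed.

Lemma supp_scale p v t :
  in_supp (p *: v) t ->
  exists h u, [/\ h \in msupp p, in_supp v (u, t.2) & t.1 = (h + u)%MM].
Proof.
rewrite /in_supp /term_coef ffunE.
move=> nz; have /msuppM_le/allpairsP[[h u] /= [hp uv ->]] :
  t.1 \in msupp (p * (v t.2 : {mpoly A[n.+1]})) by rewrite mcoeff_msupp.
by exists h, u; split=> //; rewrite -mcoeff_msupp.
Qed.

Lemma term_coef_tmon g t : term_coef (tmon A g) t = (t == g)%:R.
Proof.
rewrite /term_coef ffunE; case: t g => [m j] [m' j'] /=.
rewrite xpair_eqE; case: (j == j'); rewrite ?mcoeff0 ?andbF // mcoeffX andbT.
by rewrite eq_sym.
Qed.

Lemma supp_tmon g t : in_supp (tmon A g) t -> t = g.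
Proof.
by rewrite /in_supp term_coef_tmon; case: (t =P g); rewrite ?eqxx.
Qed.

Lemma tmon_supp t : in_supp (tmon A t) t.
Proof. by rewrite /in_supp term_coef_tmon eqxx oner_eq0. Qed.

Lemma term_coef_shift p g h :
  term_coef (p *: tmon A g) ((h + g.1)%MM, g.2) = p@_h.
Proof. by rewrite /term_coef !ffunE eqxx addmC /= mcoeffMX. Qed.

Lemma supp_scale_tmon p g t :
  in_supp (p *: tmon A g) t -> exists2 h, h \in msupp p & t = ((h + g.1)%MM, g.2).
Proof.
case/supp_scale => h [u [hp /supp_tmon <- e]]; exists h => //=.
by rewrite -e; case: (t).
Qed.

Lemma tspan_supp G v t :
  tspan G v -> in_supp v t -> exists2 g, G g & exists u, t = ((u + g.1)%MM, g.2).
Proof.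
case=> s [sG ->] /supp_sum[c cs]; case: (sG c cs) => g Gg ->.
by case/supp_scale_tmon => h _ ->; exists g => //; exists h.
Qed.

Lemma tspan_tmon G t : G t -> tspan G (tmon A t).
Proof.
move=> Gt; exists [:: (1, tmon A t)]; rewrite big_seq1 scale1r; split=> // c.
by rewrite inE => /eqP ->; exists t.
Qed.

Lemma tspan_tmon_mul G g h : G g -> tspan G (tmon A ((h + g.1)%MM, g.2)).
Proof.
move=> Gg; exists [:: ('X_[h], tmon A g)]; rewrite big_seq1; split=> [c|].
  by rewrite inE => /eqP ->; exists g.
apply/ffunP => j; rewrite !ffunE /=; case: (j == g.2); last by rewrite scaler0.
by rewrite mpolyXD.
Qed.

Lemma tspan_sub G G' v : (forall t, G t -> G' t) -> tspan G v -> tspan G' v.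
Proof.
move=> GG' [s [sG ->]]; exists s; split=> // c /sG[t /GG' Gt ->].
by exists t.
Qed.

End Supports.

(** * Cone writings with respect to a marked set *)

Section Writings.

Variables (A : comNzRingType) (n m : nat) (d : 'I_m -> int).
Variables (U : free_mod A n 'I_m -> Prop) (P : {fset term n 'I_m}).
Variable F : P -> free_mod A n 'I_m.
Hypothesis (PU : pommaret_basis U (fun t => t \in P)) (mF : marked_set d U F).
Implicit Types (a c : P) (i j : 'I_n.+1) (h u : 'X_{1..n.+1}).

Lemma in_cone_U c u : cone (val c).1 u -> U (tmon A (u, (val c).2)).
Proof. by move=> cu; case: PU => _ U_P _; apply/U_P; exists (val c); rewrite ?fsvalP. Qed.

Lemma marked_supp c t :
  in_supp (F c) t -> t = val c \/ normal_terms U t.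
Proof.
move=> ct; case: (mF c) => _ _ tail.
have [|ne] := eqVneq t (val c); [by left | right; apply: tail].
by rewrite /in_supp term_coefB term_coef_tmon (negPf ne) subr0.
Qed.

Lemma marked_tail c t :
  in_supp (F c - tmon A (val c)) t -> normal_terms U t /\ in_supp (F c) t.
Proof.
move=> ct; case: (mF c) => _ _ /(_ _ ct) Nt; split=> //.
move: ct; rewrite /in_supp term_coefB term_coef_tmon.
have [e|_] := eqVneq t (val c); last by rewrite subr0.
by case: Nt; rewrite e (surjective_pairing (val c)); apply: in_cone_U (cone_refl _).
Qed.

Lemma marked_deg c t : in_supp (F c) t -> tdeg d t = tdeg d (val c).
Proof.
case: (mF c) => -[s hs] c1 _ /hs ->; apply/esym/hs.
by rewrite /in_supp c1 oner_eq0.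
Qed.

(** Induction on the terms of the coefficients, the largest ones first.  A term
    [x^h] of [Q c] is justified either by a term of [v] or by a larger term of
    some coefficient, through a tail term of the corresponding marked element. *)
Lemma cone_writing_ind (Q : P -> {mpoly A[n.+1]}) v
    (good : P -> 'X_{1..n.+1} -> Prop) :
  cone_writing F Q v ->
  (forall c h, cone (val c).1 (h + (val c).1)%MM ->
     in_supp v ((h + (val c).1)%MM, (val c).2) -> good c h) ->
  (forall c h c' h' u, good c' h' -> in_supp (F c') (u, (val c).2) ->
     (h + (val c).1 = h' + u)%MM -> revlex_lt h h' -> good c h) ->
  forall c h, h \in msupp (Q c) -> good c h.
Proof.
move=> [vE Qcone] base step.
pose s := flatten [seq (msupp (Q c) : seq _) | c : P].
have sQ c h : h \in msupp (Q c) -> h \in s.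
  move=> hc; apply/flattenP; exists (msupp (Q c)) => //.
  by apply/mapP; exists c; rewrite ?mem_enum.
suff H h : h \in s -> forall c, h \in msupp (Q c) -> good c h.
  by move=> c h hc; apply: H => //; exact: sQ hc.
move: h; apply: (finite_order_ind (@revlex_lt_irr n) (@revlex_lt_trans n)).
move=> h _ IH c hc; have ch := Qcone c h hc.
set t : term n 'I_m := ((h + (val c).1)%MM, (val c).2).
case: (boolP (term_coef v t != 0)) => [|/negbNE/eqP vt]; first exact: base.
pose tail := \sum_(c' : P) Q c' *: (F c' - tmon A (val c')).
have vt' : term_coef v t = term_coef tail t + (Q c)@_h.
  have -> : v = tail + \sum_(c' : P) Q c' *: tmon A (val c').
    by rewrite vE -big_split; apply: eq_bigr => c' _; rewrite scalerBr /= subrK.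
  rewrite term_coefD; congr (_ + _); rewrite term_coef_sum (bigD1 c) //=.
  rewrite [X in X + _]term_coef_shift big1 ?addr0 // => c' ne.
  apply/eqP; apply: contraNT ne => /supp_scale_tmon[h' h'c' et].
  (* Disjointness of the cones: only the head of [F c] reaches [t]. *)
  case: PU => _ _ disj; apply/eqP/val_inj/(disj _ _ t); rewrite ?fsvalP //.
  by rewrite et; split=> //; exact: Qcone.
have /supp_sum[c' _ /supp_scale[h' [u [h'c' ut e]]]] : in_supp tail t.
  rewrite /in_supp; apply: contraTneq hc => t0.
  by move: vt'; rewrite vt t0 add0r mcoeff_msupp negbK => <-.
have [Nu Fu] := marked_tail ut.
have lt : revlex_lt h h'.
  by apply: tail_collision_lt ch _ e => /in_cone_U.
by apply: step (IH _ (sQ _ _ h'c') lt _ h'c') Fu e lt.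
Qed.

(** Here [good] bounds the variables and fixes the degree.  A collision makes
    [x^h] lexicographically smaller than [x^h'], which keeps its variables below
    [x_i] if those of [x^h'] are, and homogeneity of the marked elements keeps
    the degree. *)
Lemma prolongation_low (Q : P -> {mpoly A[n.+1]}) a i :
  nonmult (val a).1 i -> cone_writing F Q ('X_i *: F a) ->
  forall c h, h \in msupp (Q c) ->
  (forall j : 'I_n.+1, (i <= j)%N -> h j = 0%N) /\
  (mdeg h)%:Z = tdeg d (val a) + 1 - tdeg d (val c).
Proof.
move=> nai Qw; apply: (cone_writing_ind Qw) => [c h ch|c h c' h' u].
  case/supp_scale => h' [u [/=]]; rewrite msuppX inE => /eqP -> Fu e.
  split; last first.
    have := congr1 mdeg e; rewrite !mdegD mdeg1 => ed.
    by have := marked_deg Fu; rewrite /tdeg /=; lia.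
  apply: (shift_cone_low ch e) => cu.
  case: (marked_supp Fu) => [ua|]; last by case; exact: in_cone_U.
  case: PU => _ _ disj.
  suff -> : val c = val a by [].
  apply: (disj _ _ (u, (val c).2)); rewrite ?fsvalP //.
  by rewrite ua; split=> //; exact: cone_refl.
move=> [low' deg'] Fu e /revlex_ltP[j lj above]; split.
  move=> k ik; case: (ltngtP j k) => [jk|kj|/val_inj jk].
  - by rewrite above // low'.
  - by move: lj; rewrite low' // (leq_trans ik) // ltnW.
  - by move: lj; rewrite jk low'.
have := congr1 mdeg e; rewrite !mdegD => ed.
by have := marked_deg Fu; move: deg' ed; rewrite /tdeg /=; lia.
Qed.

End Writings.

(** * The stable module of leading terms of the syzygies *)

Section SyzygyHeads.

Variables (A : comNzRingType) (n m : nat) (P : {fset term n 'I_m}).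
Implicit Types (t g : term n P).

Definition syz_head_set : {fset term n P} :=
  [fset t in image (fun p : 'I_n.+1 * P => (U_(p.1)%MM, p.2) : term n P)
                   (fun p => nonmult (val p.2).1 p.1)]%fset.

Lemma syz_head_setP t : syz_heads t <-> t \in syz_head_set.
Proof.
rewrite in_fset /=; split=> [[i [ni e]]|/imageP[[i a] /= ni ->]]; last by exists i.
by apply/imageP; exists (i, t.2) => //; case: t e {ni} => ? ? /= ->.
Qed.

Lemma syz_headsI (a : P) i : nonmult (val a).1 i -> syz_heads (U_(i)%MM, a).
Proof. by move=> ni; exists i. Qed.

(** A multiple of [x_i f_c] is in the cone of [x_j f_c] for [x_j] the largest
    variable of its monomial: [x_j] is non-multiplicative because [j >= i]. *)
Lemma syz_heads_cone_exists g u :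
  syz_heads g ->
  exists2 g' : term n P, syz_heads g' & tcone g' ((u + g.1)%MM, g.2).
Proof.
case: g => _ c [i [/= ni ->]]; set h := (u + _)%MM.
have hi : h i != 0%N by rewrite mnmDE mnm1E eqxx addn1.
case: (@arg_maxnP _ i (fun j => h j != 0%N) val hi) => j hj jmax.
have hE : h = (h - U_(j) + U_(j))%MM.
  rewrite submK //; apply/mnm_lepP => k; rewrite mnm1E.
  by case: eqP => // <-; rewrite lt0n.
exists (U_(j)%MM, c); first exact/syz_headsI/(leq_trans ni)/jmax.
split=> //=; rewrite hE; apply/coneXP => k jk; rewrite mnmBE.
have [->|/jmax /=] := eqVneq (h k) 0%N; first by rewrite sub0n.
by rewrite leqNgt jk.
Qed.

Lemma syz_heads_disjoint g g' t :
  syz_heads g -> syz_heads g' -> tcone g t -> tcone g' t -> g = g'.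
Proof.
case: g g' => [b c] [b' c'] [i [/= _ ->]] [j [/= _ ->]] [/= ci <-] [/= cj <-].
by rewrite (unit_cones_disjoint ci cj).
Qed.

Definition syz_module : free_mod A n P -> Prop := tspan (@syz_heads n m P).

(** The lemmas below take any predicate [G] equivalent to [syz_heads], so that
    they apply both to [syz_heads] itself and to membership in [syz_head_set]. *)
Lemma syz_module_generates (G : term n P -> Prop) :
  (forall t, syz_heads t <-> G t) -> generates G syz_module.
Proof. by move=> GE v; split; apply: tspan_sub => t /GE. Qed.

Lemma syz_module_pommaret (G : term n P -> Prop) :
  (forall t, syz_heads t <-> G t) -> pommaret_basis syz_module G.
Proof.
move=> GE; split; first exact: syz_module_generates.
- move=> t; split=> [/tspan_supp/(_ (tmon_supp A t))[g hg [u ->]]|].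
    by have [g' /GE] := syz_heads_cone_exists u hg; exists g'.
  case=> g /GE hg [[u [_ e]] e2]; case: t e e2 => /= _ _ -> ->.
  exact: tspan_tmon_mul.
- by move=> g g' t /GE hg /GE hg'; apply: syz_heads_disjoint.
Qed.

(** All heads have degree one, so none divides another, and a generating subset
    must contain each of them. *)
Lemma syz_module_minimal (G : term n P -> Prop) :
  (forall t, syz_heads t <-> G t) -> minimal_generators syz_module G.
Proof.
move=> GE; split=> [|G' G'G genG' t /GE ht]; first exact: syz_module_generates.
have /genG' /tspan_supp /(_ (tmon_supp A t))[g G'g [u e]] : syz_module (tmon A t).
  exact: tspan_tmon.
have [j [_ gj]] : syz_heads g by exact/GE/G'G.
suff u0 : u = 0%MM by rewrite e u0 add0m -surjective_pairing.
case: ht => i [_]; rewrite e gj /= => /(congr1 mdeg).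
by rewrite mdegD !mdeg1 => /eqP; rewrite -[X in _ == X]add0n eqn_add2r mdeg_eq0 => /eqP.
Qed.

Lemma syz_module_stable : stable syz_module.
Proof.
split; first by exists (@syz_heads n m P).
exists syz_head_set; split; [apply: syz_module_pommaret | apply: syz_module_minimal];
  exact: syz_head_setP.
Qed.

End SyzygyHeads.

Theorem corollary2p14 (K : fieldType) (A : comAlgType K) (n m : nat)
    (d : 'I_m -> int) (U : free_mod A n 'I_m -> Prop)
    (P : {fset term n 'I_m}) (F : P -> free_mod A n 'I_m) :
  noetherian A ->
  quasi_stable U ->
  pommaret_basis U (fun t => t \in P) ->
  marked_basis d U F ->
  (exists U' : free_mod A n P -> Prop,
     stable U' /\ pommaret_basis U' (@syz_heads n m P)) /\
  (forall U' : free_mod A n P -> Prop,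
     stable U' -> pommaret_basis U' (@syz_heads n m P) ->
   forall (a : P) (i : 'I_n.+1), nonmult (val a).1 i ->
   forall S : free_mod A n P, fundamental_syzygy F i a S ->
   forall t : term n P, in_supp S t ->
     t = (U_(i)%MM, a) \/
     [/\ sliced_cone i (val t.2).1 (t.1 + (val t.2).1)%MM,
         (mdeg t.1)%:Z = tdeg d (val a) + 1 - tdeg d (val t.2)
       & normal_terms U' t]).
Proof.
move=> _ _ PU [mF _]; split.
  by exists (@syz_module A n m P); split;
    [exact: syz_module_stable | exact: syz_module_pommaret].
move=> U' _ [_ U'_heads _] a i ni S [Q [Qw ->]] t tS.
have [|ne] := eqVneq t (U_(i)%MM, a); [by left | right].
have {tS} tQ : t.1 \in msupp (Q t.2).
  have /supp_sum[c _ /supp_scale_tmon[h hc ->]] :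
      in_supp (\sum_(c : P) Q c *: tmon A (0%MM, c)) t.
    move: tS; rewrite /in_supp term_coefB.
    rewrite [X in X - _](_ : _ = 0); first by rewrite sub0r oppr_eq0.
    apply/eqP; apply: contraNT ne => /supp_scale_tmon[h].
    by rewrite msuppX inE => /eqP -> ->; rewrite /= addm0.
  by rewrite addm0.
have [low deg] := prolongation_low PU mF ni Qw tQ.
have ct := Qw.2 _ _ tQ.
split=> //; first exact: sliced_coneI.
case/U'_heads => g [j [nj gj]] [[u [_ e]] e2].
have /coneP/(_ j) := ct; rewrite e2 => /(_ nj).
by rewrite e gj mnmDE mnm1E eqxx addn1.
Qed.
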